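(* Let $\mathcal{W}$ be the class of all nonempty weakly convex compact metric spaces. The assignment $\mathcal{W}\ni X\mapsto c_X\in X$ of the generalized Chebyshev center is a strict distinguishing; that is, for any $X,Y\in\mathcal{W}$ and any isometry $\Phi$ of $X$ onto $Y$, one has $\Phi(c_X)=c_Y$.
   Context: A metric space $(X,d)$ is weakly convex if for any two points $x,y\in X$ there is a point $z\in X$ such that for each $w\in X$: (C1) $d(z,w)\le\max(d(x,w),d(y,w))$; and (C2) if $d(z,w)=\max(d(x,w),d(y,w))$ then $d(x,w)=d(y,w)$. For a metric space $(X,d)$ and $x\in X$ put $r_X(x):=\sup_{y\in X}d(x,y)$, and put $r(X):=\inf_{x\in X}r_X(x)$ (with $r(\varnothing):=0$). The Chebyshev center of $X$ is the set $C(X):=\{x\in X: r_X(x)=r(X)\}$, regarded as a metric space with the restricted metric. Define $C^0(X):=X$, $C^n(X):=C(C^{n-1}(X))$ for $n>0$, and $C^{\infty}(X):=\bigcap_{n=0}^{\infty}C^n(X)$. For a nonempty weakly convex compact metric space $X$ the set $C^\infty(X)$ consists of exactly one point; this point is called the generalized Chebyshev center of $X$ and denoted $c_X$. *)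

(* Defs.v *)
From HB Require Import structures.
From mathcomp Require Import all_boot all_order all_algebra.
From mathcomp Require Import all_classical all_reals all_analysis.

Set Implicit Arguments.
Unset Strict Implicit.
Unset Printing Implicit Defensive.

Import Order.TTheory GRing.Theory Num.Theory.

Local Open Scope classical_set_scope.
Local Open Scope ring_scope.

Definition weakly_convex (R : realType) (X : metricType R) : Prop :=
  forall x y : X, exists z : X, forall w : X,
    mdist z w <= Num.max (mdist x w) (mdist y w) /\
    (mdist z w = Num.max (mdist x w) (mdist y w) -> mdist x w = mdist y w).

(* A subset A of X stands for the metric space A with the restricted metric,
   so the notions below are relative to A.  Radii live in \bar R, since the
   supremum is +oo when A is unbounded. *)
Definition radius_at (R : realType) (X : metricType R) (A : set X) (x : X)
    : \bar R :=
  ereal_sup [set (mdist x y)%:E | y in A].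

(* The case split is needed because ereal_inf set0 = +oo. *)
Definition radius (R : realType) (X : metricType R) (A : set X) : \bar R :=
  if `[< A = set0 >] then 0%E else ereal_inf [set radius_at A x | x in A].

Definition cheb_center (R : realType) (X : metricType R) (A : set X) : set X :=
  [set x | A x /\ radius_at A x = radius A].

Definition cheb_center_iter (R : realType) (X : metricType R) (n : nat)
    : set X :=
  iter n (@cheb_center R X) [set: X].
Arguments cheb_center_iter {R} X n.

Definition cheb_center_infty (R : realType) (X : metricType R) : set X :=
  \bigcap_n cheb_center_iter X n.
Arguments cheb_center_infty {R} X.

Record wcc_metric (R : realType) := WccMetric {
  wcc_sort :> metricType R;
  wcc_nonempty : [set: wcc_sort] !=set0;
  wcc_weakly_convex : weakly_convex wcc_sort;
  wcc_compact : compact [set: wcc_sort] }.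

(* The unique c such that the intersection of all iterated Chebyshev centers
   is {c}.  The inhabitant obtained from nonemptiness is only the default value
   that xget requires. *)
Definition gen_cheb_center (R : realType) (X : wcc_metric R) : X :=
  xget (projT1 (cid (wcc_nonempty X)))
    [set c : X | cheb_center_infty X = [set c]].

Definition isometry_onto (R : realType) (X Y : metricType R) (Phi : X -> Y)
    : Prop :=
  (forall x x' : X, mdist (Phi x) (Phi x') = mdist x x') /\
  (forall y : Y, exists x : X, Phi x = y).

(* Main.v *)
From Pilot Require Import Defs.
From mathcomp Require Import all_boot all_order all_algebra.
From mathcomp Require Import all_classical all_reals all_analysis.
From mathcomp Require Import lra.

Set Implicit Arguments.
Unset Strict Implicit.
Unset Printing Implicit Defensive.

Import Order.TTheory GRing.Theory Num.Theory.
Import numFieldNormedType.Exports.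
(* MathComp-Analysis has a [radius] of balls, which would shadow [Defs.radius]. *)
Import Pilot.Defs.

Local Open Scope classical_set_scope.
Local Open Scope ring_scope.

(** Iterated Chebyshev centers are defined by distances alone, so an isometry
    of X onto Y carries the iterated centers of X to those of Y; it remains to
    see that their intersection K is a single point.  In a compact space K is
    nonempty, and by compactness every x in K has the same farthest distance r
    inside K, namely the infimum of the radii of the iterated centers.  The
    point z that weak convexity provides for x, y in K lies in K by (C1), and
    by (C2) the points of K at distance r from z are at distance r from both x
    and y.  Hence the sets of farthest points form a directed family of
    nonempty compact sets; a common point w is at distance r from itself, so
    r = 0. *)

(** The [F i] are a base of a proper filter; by compactness it clusters at some point, which lies in
    each closed [F i]. *)
Lemma compact_directed_bigcap (T : topologicalType) (I : Type) (D : set I)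
    (F : I -> set T) :
  compact [set: T] -> D !=set0 ->
  (forall i, D i -> closed (F i)) -> (forall i, D i -> F i !=set0) ->
  (forall i j, D i -> D j -> exists2 k, D k & F k `<=` F i `&` F j) ->
  \bigcap_(i in D) F i !=set0.
Proof.
move=> cT D0 Fcl F0 Fdir.
have FF := filter_from_filter D0 Fdir.
have [p [_ +]] := cT _ (filter_from_proper FF F0) filterT.
rewrite clusterE => clp; exists p => i Di.
by apply: (Fcl _ Di); apply: clp; exists i.
Qed.

(** * Chebyshev centers and their iterates *)

Section chebyshev_center.
Context {R : realType} {X : metricType R}.
Implicit Types (A : set X) (x y w : X) (e : \bar R).

Lemma mdist_continuous x : continuous (mdist x : X -> R).
Proof.
move=> y; apply/cvgrPdist_lt => e e0; near=> z.
have yz : mdist y z < e.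
  have : ball y e z by near: z; exact: nbhsx_ballx.
  by rewrite ballEmdist.
have := metric_triangle x y z; have := metric_triangle x z y.
rewrite (metric_sym z y) => h1 h2.
by rewrite ltr_norml; apply/andP; split; lra.
Unshelve. all: by end_near. Qed.

Lemma closed_mdist_le x e : closed [set w | ((mdist x w)%:E <= e)%E].
Proof.
case: e => [r| |].
- under eq_set do rewrite lee_fin.
  by apply: (closed_comp (f := mdist x)) (@closed_le _ r) => y _;
    exact: mdist_continuous.
- rewrite (_ : mkset _ = setT); first exact: closedT.
  by apply/seteqP; split=> // w _ /=; rewrite leey.
- by rewrite (_ : mkset _ = set0); [exact: closed0|apply/seteqP; split].
Qed.

Lemma closed_mdist_ge x e : closed [set w | (e <= (mdist x w)%:E)%E].
Proof.
case: e => [r| |].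
- under eq_set do rewrite lee_fin.
  by apply: (closed_comp (f := mdist x)) (@closed_ge _ r) => y _;
    exact: mdist_continuous.
- by rewrite (_ : mkset _ = set0); [exact: closed0|apply/seteqP; split].
- rewrite (_ : mkset _ = setT); first exact: closedT.
  by apply/seteqP; split=> // w _ /=; rewrite leNye.
Qed.

Lemma radius_at_leP A x e :
  (radius_at A x <= e)%E <-> forall y, A y -> ((mdist x y)%:E <= e)%E.
Proof.
split=> [xe y Ay|xe]; last by apply: ge_ereal_sup => _ [y Ay <-]; exact: xe.
by apply: le_trans xe; apply: ereal_sup_ubound; exists y.
Qed.

(** By symmetry of the distance, the sublevel set is an intersection of closed sets, one for each
    point of [A]. *)
Lemma closed_radius_at_le A e : closed [set x | (radius_at A x <= e)%E].
Proof.
have -> : [set x | (radius_at A x <= e)%E] =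
    \bigcap_(y in A) [set x | ((mdist y x)%:E <= e)%E].
  apply/seteqP; split=> x /=.
    by move/radius_at_leP => xe y /xe /=; rewrite metric_sym.
  by move=> xe; apply/radius_at_leP => y /xe /=; rewrite metric_sym.
by apply: closed_bigI => y _; exact: closed_mdist_le.
Qed.

Lemma radius_nonempty A :
  A !=set0 -> radius A = ereal_inf [set radius_at A x | x in A].
Proof.
move=> [a Aa]; rewrite /radius; case: asboolP => // A0.
by move: Aa; rewrite A0.
Qed.

Lemma radius_le A x : A x -> (radius A <= radius_at A x)%E.
Proof.
by move=> Ax; rewrite radius_nonempty; [apply: ereal_inf_lbound|]; exists x.
Qed.

(** [radius A] is a lower bound on [A], so equality reduces to an inequality, which is a closed
    condition. *)
Lemma cheb_centerE A :
  cheb_center A = A `&` [set x | (radius_at A x <= radius A)%E].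
Proof.
apply/seteqP; split=> x [Ax]; first by move=> xA; split=> //=; rewrite xA.
by move=> xA; split=> //; apply/eqP; rewrite eq_le xA radius_le.
Qed.

Lemma closed_cheb_center A : closed A -> closed (cheb_center A).
Proof.
by move=> cA; rewrite cheb_centerE; apply: closedI; first exact: cA;
  exact: closed_radius_at_le.
Qed.

Lemma cheb_center_iterS n :
  cheb_center_iter X n.+1 = cheb_center (cheb_center_iter X n).
Proof. by []. Qed.

Lemma closed_cheb_center_iter n : closed (cheb_center_iter X n).
Proof.
elim: n => [|n IHn]; first exact: closedT.
by rewrite cheb_center_iterS; exact: closed_cheb_center.
Qed.

Lemma cheb_center_iter_le m n : (m <= n)%N ->
  cheb_center_iter X n `<=` cheb_center_iter X m.
Proof.
elim: n => [|n IHn]; first by rewrite leqn0 => /eqP ->.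
rewrite leq_eqVlt => /predU1P[-> //|/IHn mn].
by rewrite cheb_center_iterS => x [/mn].
Qed.

(* The radii of the iterated centers decrease to this common value. *)
Let r := ereal_inf (range (fun n => radius (cheb_center_iter X n))).

Lemma mdist_cheb_center_infty_le x w :
  cheb_center_infty X x -> cheb_center_infty X w -> ((mdist x w)%:E <= r)%E.
Proof.
move=> Kx Kw; apply: le_ereal_inf_tmp => _ [n _ <-].
(* Membership in iterate [n.+1] identifies the radius of iterate [n] with the farthest distance from
   [x] in it. *)
have [_ <-] := Kx n.+1 I.
by apply: ereal_sup_ubound; exists w => //; exact: Kw.
Qed.

(** By (C1), no point of an iterate is farther from [z] than from both [x] and [y], so [z] stays in
    every iterate by induction. *)
Lemma cheb_center_infty_weakly_convex x y :
  weakly_convex X -> cheb_center_infty X x -> cheb_center_infty X y ->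
  exists2 z, cheb_center_infty X z & forall w,
    mdist z w <= Num.max (mdist x w) (mdist y w) /\
    (mdist z w = Num.max (mdist x w) (mdist y w) -> mdist x w = mdist y w).
Proof.
move=> wcX Kx Ky; have [z Hz] := wcX x y; exists z => // n _.
elim: n => [//|n IHn]; rewrite cheb_center_iterS cheb_centerE; split=> //=.
apply/radius_at_leP => w Aw.
move: (Kx n.+1 I) (Ky n.+1 I); rewrite cheb_center_iterS !cheb_centerE.
move=> [_ /radius_at_leP/(_ w Aw) xw] [_ /radius_at_leP/(_ w Aw) yw].
apply: (@le_trans _ _ (Num.max (mdist x w) (mdist y w))%:E).
  by rewrite lee_fin; have [] := Hz w.
by case: (leP (mdist x w)).
Qed.

(** * Consequences of compactness *)

Hypothesis cX : compact [set: X].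

Lemma radius_at_attained A x : closed A -> A !=set0 ->
  exists2 w, A w & radius_at A x = (mdist x w)%:E.
Proof.
move=> clA A0; have cA : compact A := subclosed_compact clA cX (@subsetT _ A).
have [|w /set_mem Aw max_w] := @compact_EVT_max X R (mdist x) A A0 cA.
  by apply: continuous_subspaceT => y; exact: mdist_continuous.
exists w => //; apply/eqP; rewrite eq_le; apply/andP; split.
  by apply/radius_at_leP => y Ay; rewrite lee_fin max_w// inE.
by apply: ereal_sup_ubound; exists w.
Qed.

(** A point common to the sublevel sets of [radius_at A] at all levels above [radius A] attains the
    infimum. *)
Lemma cheb_center_nonempty A : closed A -> A !=set0 -> cheb_center A !=set0.
Proof.
move=> clA A0; have Aoo : (radius A < +oo)%E.
  have [a Aa] := A0; have [w _ aw] := radius_at_attained a clA A0.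
  by apply: le_lt_trans (radius_le Aa) _; rewrite aw ltry.
have [||e /= Ae|e f /= Ae Af|] := @compact_directed_bigcap X (\bar R)
    [set e | (radius A < e)%E] (fun e => A `&` [set x | (radius_at A x <= e)%E])
    cX.
- by exists +oo%E.
- by move=> e _; apply: closedI => //; exact: closed_radius_at_le.
- move: Ae; rewrite radius_nonempty// => /ereal_inf_lt[_ [x Ax <-]] xe.
  by exists x; split=> //=; exact: ltW.
- exists (Order.min e f) => /=; first by rewrite lt_min Ae.
  by move=> x [Ax] /=; rewrite le_min => /andP[].
move=> x Ax; exists x; rewrite cheb_centerE; split=> /=; first by case: (Ax _ Aoo).
have [w _ xw] := radius_at_attained x clA A0; rewrite xw.
have Ale e : (radius A < e)%E -> ((mdist x w)%:E <= e)%E.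
  by rewrite -xw => /Ax[].
(* A finite radius is approached by levels decreasing to it; the value -oo is refuted by the level
   [mdist x w - 1]. *)
move: Aoo Ale; case: (radius A) => [s _ Ale|//|_ Ale].
  by apply/lee_addgt0Pr => e e0; apply: Ale; rewrite -EFinD lte_fin ltrDl.
by have := Ale (mdist x w - 1)%:E (ltNyr _); rewrite lee_fin lerBrDr gerDl ler10.
Qed.

Lemma cheb_center_iter_nonempty n :
  [set: X] !=set0 -> cheb_center_iter X n !=set0.
Proof.
move=> X0; elim: n => [//|n IHn]; rewrite cheb_center_iterS.
by apply: cheb_center_nonempty => //; exact: closed_cheb_center_iter.
Qed.

Lemma cheb_center_infty_nonempty :
  [set: X] !=set0 -> cheb_center_infty X !=set0.
Proof.
move=> X0; apply: compact_directed_bigcap => //.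
- by move=> n _; exact: closed_cheb_center_iter.
- by move=> n _; exact: cheb_center_iter_nonempty.
- move=> m n _ _; exists (maxn m n) => // x Ax.
  by split; move: Ax; apply: cheb_center_iter_le; rewrite ?leq_maxl ?leq_maxr.
Qed.

(** As [x] lies in iterate [n.+1], its farthest point in iterate [n] is at distance the radius of
    that iterate, hence at least [r]; compactness yields one such point common to all iterates. *)
Lemma cheb_center_infty_farthest x : cheb_center_infty X x ->
  exists2 w, cheb_center_infty X w & (r <= (mdist x w)%:E)%E.
Proof.
move=> Kx.
have [||n _|m n _ _|w Kw] := @compact_directed_bigcap X nat setT
  (fun n => cheb_center_iter X n `&` [set w | (r <= (mdist x w)%:E)%E]) cX.
- by exists 0%N.
- move=> n _; apply: closedI; first exact: closed_cheb_center_iter.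
  exact: closed_mdist_ge.
- have An0 : cheb_center_iter X n !=set0 by exists x; exact: Kx.
  have [w Aw xw] := radius_at_attained x (@closed_cheb_center_iter n) An0.
  exists w; split=> //=; rewrite -xw.
  by have [_ ->] := Kx n.+1 I; apply: ereal_inf_lbound; exists n.
- exists (maxn m n) => // w [Aw rw].
  split; split=> //; move: Aw; apply: cheb_center_iter_le.
    exact: leq_maxl.
  exact: leq_maxr.
- by exists w => [n _|]; [have [] := Kw n I | have [] := Kw 0%N I].
Qed.

Lemma cheb_center_infty_singleton :
  [set: X] !=set0 -> weakly_convex X ->
  exists c, cheb_center_infty X = [set c].
Proof.
move=> X0 wcX; have K0 := cheb_center_infty_nonempty X0.
have [|x Kx|x y Kx Ky|w Kw] := @compact_directed_bigcap X X
  (cheb_center_infty X)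
  (fun x => cheb_center_infty X `&` [set w | (r <= (mdist x w)%:E)%E]) cX K0.
- move=> x Kx; apply: closedI; last exact: closed_mdist_ge.
  by apply: closed_bigI => n _; exact: closed_cheb_center_iter.
- by have [w Kw rw] := cheb_center_infty_farthest Kx; exists w.
- have [z Kz Hz] := cheb_center_infty_weakly_convex wcX Kx Ky.
  exists z => // w [Kw /= rz].
  have [zw zw_eq] := Hz w.
  have xr := mdist_cheb_center_infty_le Kx Kw.
  have yr := mdist_cheb_center_infty_le Ky Kw.
  (* [w] is at least [r] away from [z] and at most [r] from [x] and [y], which forces equality in
     (C1), so (C2) applies. *)
  have zwE : mdist z w = Num.max (mdist x w) (mdist y w).
    apply/eqP; rewrite eq_le zw /= -lee_fin; apply: le_trans rz.
    by case: (leP (mdist x w)).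
  have xyw := zw_eq zwE; move: zwE; rewrite -xyw maxxx => zx.
  by split; split=> //=; rewrite -?xyw -zx.
(* Index [c] places [w] in the intersection; then [w] itself is a legitimate index and gives [r] at
   most 0. *)
have [c Kc] := K0; have [Kw' _] := Kw _ Kc; have [_ /=] := Kw _ Kw'.
rewrite mdistxx => r0; exists c; apply/seteqP; split=> [x Kx|x ->//] /=.
apply: mdist_positivity; apply/eqP; rewrite eq_le mdist_ge0 andbT -lee_fin.
exact: le_trans (mdist_cheb_center_infty_le Kx Kc) r0.
Qed.

End chebyshev_center.

(** * Invariance under isometries *)

Section isometry.
Context {R : realType} {X Y : metricType R} (Phi : X -> Y).
Hypothesis isoPhi : isometry_onto Phi.

Lemma isometry_radius_at (B : set Y) x :
  radius_at (Phi @^-1` B) x = radius_at B (Phi x).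
Proof.
have [Phi_dist Phi_surj] := isoPhi; congr ereal_sup; apply/seteqP; split.
  by move=> _ [y By <-]; exists (Phi y) => //; rewrite Phi_dist.
move=> _ [y By <-]; have [x' yE] := Phi_surj y; move: By; rewrite -yE => By.
by exists x' => //; rewrite Phi_dist.
Qed.

Lemma isometry_radius (B : set Y) : radius (Phi @^-1` B) = radius B.
Proof.
have [_ Phi_surj] := isoPhi.
(* The empty set is treated apart, since [radius] is 0 there by convention and not an infimum. *)
have [->|/set0P[y By]] := eqVneq B set0.
  by rewrite preimage_set0 /radius !asboolT.
have [x yE] := Phi_surj y.
rewrite !radius_nonempty; [|by exists y|by exists x; rewrite /= yE].
congr ereal_inf; apply/seteqP; split=> [_ [x' Bx' <-]|_ [y' By' <-]].
  by exists (Phi x') => //; rewrite isometry_radius_at.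
have [x' y'E] := Phi_surj y'; move: By'; rewrite -y'E => By'.
by exists x' => //; rewrite isometry_radius_at.
Qed.

Lemma isometry_cheb_center_iter n :
  cheb_center_iter X n = Phi @^-1` cheb_center_iter Y n.
Proof.
elim: n => [|n IHn]; first by rewrite preimage_setT.
rewrite !cheb_center_iterS IHn; apply/seteqP.
by split=> x [Ax xr]; split=> //; move: xr;
  rewrite isometry_radius_at isometry_radius.
Qed.

Lemma isometry_cheb_center_infty x :
  cheb_center_infty X x -> cheb_center_infty Y (Phi x).
Proof.
by move=> Kx n _; have := Kx n I; rewrite isometry_cheb_center_iter.
Qed.

End isometry.

(** A suitable point exists, so [xget] returns one instead of its default. *)
Lemma gen_cheb_centerP (R : realType) (X : wcc_metric R) :
  cheb_center_infty X = [set gen_cheb_center X].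
Proof.
have [c Kc] := cheb_center_infty_singleton (@wcc_compact _ X)
  (wcc_nonempty X) (@wcc_weakly_convex _ X).
exact: (@xgetPex _ _ [set c : X | cheb_center_infty X = [set c]] (ex_intro _ c Kc)).
Qed.

Theorem theorem3p6 (R : realType) (X Y : wcc_metric R) (Phi : X -> Y)
    (hPhi : isometry_onto Phi) :
  Phi (gen_cheb_center X) = gen_cheb_center Y.
Proof.
have : cheb_center_infty Y (Phi (gen_cheb_center X)).
  by apply: (isometry_cheb_center_infty hPhi); rewrite gen_cheb_centerP.
by rewrite gen_cheb_centerP.
Qed.
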